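(* $BS(1,2)$ contains a positive density of elements $g$ with positive, negative and zero conjugation curvature $\kappa_1(g)$; that is, there are sets $\mathcal{A}_+,\mathcal{A}_-,\mathcal{A}_0\subset BS(1,2)$, each of positive density in $BS(1,2)$, such that $\kappa_1(g)>0$ for every $g\in\mathcal{A}_+$, $\kappa_1(g)<0$ for every $g\in\mathcal{A}_-$, and $\kappa_1(g)=0$ for every $g\in\mathcal{A}_0$.
   Context: $BS(1,2)=\langle t,a \mid tat^{-1}=a^2\rangle$. Word length $l(\cdot)$ is always with respect to the generating set $\{a,t\}$ (i.e. letters $a^{\pm1},t^{\pm1}$). $S_2(r)$ denotes the sphere of radius $r$ centered at the identity in $BS(1,2)$, i.e. the set of elements of word length exactly $r$. For $g\ne e$ and an integer $r\ge 1$, the conjugation curvature is $$\kappa_r(g)=\frac{l(g)-\frac{1}{|S_2(r)|}\sum_{p\in S_2(r)} l(p^{-1}gp)}{l(g)}.$$ For $\mathcal{A}\subset BS(1,2)$ let $\mathcal{A}(N)$ be the set of elements of $\mathcal{A}$ of word length $N$. The set $\mathcal{A}$ has positive density in $BS(1,2)$ if there is $\epsilon>0$ such that for all sufficiently large $N$, $\epsilon<\frac{|\mathcal{A}(N)|}{|S_2(N)|}<1-\epsilon$. *)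

(* Defs.v *)
From HB Require Import structures.
From mathcomp Require Import all_boot all_order all_algebra.
From mathcomp Require Import generic_quotient finmap.
From mathcomp Require Import all_classical all_reals all_analysis.
Set Implicit Arguments. Unset Strict Implicit. Unset Printing Implicit Defensive.
Import Order.TTheory GRing.Theory Num.Theory.
Local Open Scope classical_set_scope.
Local Open Scope ring_scope.
Local Open Scope quotient_scope.

(* A letter (x, e): x = false is the generator a, x = true the generator t;
   e = true marks the formal inverse. *)
Definition letter : Type := (bool * bool)%type.

Definition letter_a : letter := (false, false).
Definition letter_t : letter := (true, false).
Definition letter_inv (x : letter) : letter := (x.1, ~~ x.2).

Definition word : Type := seq letter.

Definition word_inv (w : word) : word := rev (map letter_inv w).

(* The least congruence on words containing free cancellation and
   t a t^-1 = a^2. *)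
Inductive bs_eq : word -> word -> Prop :=
| bs_eq_refl w : bs_eq w w
| bs_eq_sym u v : bs_eq u v -> bs_eq v u
| bs_eq_trans u v w : bs_eq u v -> bs_eq v w -> bs_eq u w
| bs_eq_cat u u' v v' : bs_eq u u' -> bs_eq v v' -> bs_eq (u ++ v) (u' ++ v')
| bs_eq_cancel x : bs_eq [:: x; letter_inv x] [::]
| bs_eq_relator :
    bs_eq [:: letter_t; letter_a; letter_inv letter_t] [:: letter_a; letter_a].

Definition bs_eqb (u v : word) : bool := `[< bs_eq u v >].

Lemma bs_eqb_equiv : equiv_class_of bs_eqb.
Proof.
split=> [u|u v|v u w].
- exact/asboolP/bs_eq_refl.
- by apply/asboolP/asboolP => /bs_eq_sym.
- by move=> /asboolP uv /asboolP vw; apply/asboolP; exact: bs_eq_trans uv vw.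
Qed.

Canonical bs_eqb_equivRel := EquivRelPack bs_eqb_equiv.

(* BS(1,2) = < t, a | t a t^-1 = a^2 > *)
Definition BS12 : Type := {eq_quot bs_eqb}.
HB.instance Definition _ := Choice.on BS12.
HB.instance Definition _ := Quotient.on BS12.

Definition bs_class (w : word) : BS12 := \pi_BS12 w.

Lemma bs_classP u v : bs_class u = bs_class v <-> bs_eq u v.
Proof.
split=> [/eqquotP/asboolP//|uv].
by apply/eqquotP/asboolP.
Qed.

Lemma bs_class_repr (g : BS12) : bs_class (repr g) = g.
Proof. exact: reprK. Qed.

Definition bs_mul (g h : BS12) : BS12 := bs_class (repr g ++ repr h).
Definition bs_inv (g : BS12) : BS12 := bs_class (word_inv (repr g)).
Definition bs_one : BS12 := bs_class [::].

Lemma bs_eq_repr w : bs_eq (repr (bs_class w)) w.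
Proof. exact/bs_classP/bs_class_repr. Qed.

Lemma bs_mulE u v : bs_mul (bs_class u) (bs_class v) = bs_class (u ++ v).
Proof. by apply/bs_classP/bs_eq_cat; exact: bs_eq_repr. Qed.

Lemma letter_invK : involutive letter_inv.
Proof. by case=> x e; rewrite /letter_inv negbK. Qed.

Lemma word_invK : involutive word_inv.
Proof.
by move=> w; rewrite /word_inv map_rev revK -map_comp map_id_in // => x _ /=;
  rewrite letter_invK.
Qed.

Lemma bs_eq_mulwV w : bs_eq (w ++ word_inv w) [::].
Proof.
elim: w => [|x w IHw]; first exact: bs_eq_refl.
rewrite /word_inv map_cons rev_cons -cats1 catA -/(word_inv w).
apply: (@bs_eq_trans _ ([:: x] ++ [:: letter_inv x])); last exact: bs_eq_cancel.
apply: bs_eq_cat (bs_eq_refl _).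
rewrite -cat1s -catA -[X in bs_eq _ X]cats0.
exact: bs_eq_cat (bs_eq_refl _) IHw.
Qed.

Lemma bs_eq_mulVw w : bs_eq (word_inv w ++ w) [::].
Proof. by rewrite -{2}[w]word_invK; exact: bs_eq_mulwV. Qed.

Lemma bs_mulA : associative bs_mul.
Proof.
move=> g h k; rewrite -[g]bs_class_repr -[h]bs_class_repr -[k]bs_class_repr.
by rewrite !bs_mulE catA.
Qed.

Lemma bs_mul1g : left_id bs_one bs_mul.
Proof. by move=> g; rewrite -[g]bs_class_repr bs_mulE. Qed.

Lemma bs_mulg1 : right_id bs_one bs_mul.
Proof. by move=> g; rewrite -[g]bs_class_repr bs_mulE cats0. Qed.

Lemma bs_mulVg : left_inverse bs_one bs_inv bs_mul.
Proof.
move=> g; rewrite -{2}[g]bs_class_repr bs_mulE.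
exact/bs_classP/bs_eq_mulVw.
Qed.

Lemma bs_mulgV : right_inverse bs_one bs_inv bs_mul.
Proof.
move=> g; rewrite -{1}[g]bs_class_repr bs_mulE.
exact/bs_classP/bs_eq_mulwV.
Qed.

HB.instance Definition _ :=
  isGroup.Build BS12 bs_mulA bs_mul1g bs_mulg1 bs_mulVg bs_mulgV.

Definition bs_a : BS12 := bs_class [:: letter_a].
Definition bs_t : BS12 := bs_class [:: letter_t].

Lemma bs_classM u v : bs_class (u ++ v) = (bs_class u * bs_class v)%g.
Proof. by rewrite -bs_mulE. Qed.

Lemma bs_classV w : bs_class (word_inv w) = ((bs_class w)^-1)%g.
Proof.
apply: (@mulgI _ (bs_class w)); rewrite mulgV -bs_classM.
exact/bs_classP/bs_eq_mulwV.
Qed.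

Lemma BS12_relation : (bs_t * bs_a * bs_t^-1 = bs_a ^+ 2)%g.
Proof.
rewrite expg2 /bs_t /bs_a -bs_classV -!bs_classM; apply/bs_classP.
exact: bs_eq_relator.
Qed.

Lemma word_length_subproof (g : BS12) :
  exists n, `[< exists2 w : word, size w = n & bs_class w = g >].
Proof.
exists (size (repr g)); apply/asboolP; exists (repr g) => //.
exact: bs_class_repr.
Qed.

Definition word_length (g : BS12) : nat := ex_minn (word_length_subproof g).

Definition sphere (r : nat) : set BS12 := [set g | word_length g = r].

(* Finiteness makes [fset_set] and the finitely supported sum below
   meaningful on spheres (both are trivial on infinite sets). *)
Lemma finite_sphere (r : nat) : finite_set (sphere r).
Proof.
apply: (@sub_finite_set _ _ [set bs_class (val w) | w in [set: r.-tuple letter]]).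
  move=> g /=; rewrite /sphere /= /word_length.
  case: ex_minnP => n /asboolP[w sw <-] _ nr.
  have sz : size w == r by rewrite sw nr.
  by exists (Tuple sz).
exact/finite_image/finite_finset.
Qed.

Definition bs_card (A : set BS12) : nat := #|` fset_set A|%fset.

Definition conj_curvature (R : realType) (r : nat) (g : BS12) : R :=
  ((word_length g)%:R
   - (bs_card (sphere r))%:R^-1
     * \sum_(p \in sphere r) ((word_length (p^-1 * g * p)%g)%:R : R))
  / (word_length g)%:R.

Definition positive_density (R : realType) (A : set BS12) : Prop :=
  exists2 eps : R, 0 < eps &
    \forall N \near \oo,
      eps < (bs_card (A `&` sphere N))%:R / (bs_card (sphere N))%:R < 1 - eps.

(* Main.v *)
Require Import Defs.
From HB Require Import structures.
From mathcomp Require Import all_boot all_order all_algebra.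
From mathcomp Require Import finmap.
From mathcomp Require Import all_classical all_reals all_analysis.
From mathcomp Require Import zify ring.
Set Implicit Arguments. Unset Strict Implicit. Unset Printing Implicit Defensive.
Import Order.TTheory GRing.Theory Num.Theory.
Local Open Scope classical_set_scope.
Local Open Scope ring_scope.

(** Every element is t^-p a^n t^k.  Reading a word as a walk on the powers of t
    along which the letters a are dropped, the element records the number
    n / 2^p = sum of +-2^height over the letters a, and the final height k - p.
    When the fraction is reduced the walk must go down to height -p, so it has
    at least p + k letters t (bs_nf has k >= 0), and at least wt n letters a,
    where wt n is the least number of signed powers of two with sum n.  If
    moreover |n| <= 2^k, the walk that goes down p steps and then up k steps can
    realise wt n, whence the exact formula  length = p + k + wt n
    (word_length_nf).

    Conjugating by a^+-1 changes n by +-(2^p - 2^k), that is, one binary digit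
    at each end of the walk, and conjugating by t^+-1 changes p and k by one.
    The two ends contribute independently, so the sign of the curvature can be
    prescribed by the digits of n near both ends.  This is done for three
    shapes of n, in which a middle block v written in a sparse (non-adjacent)
    signed binary form is arbitrary (zero_elt, pos_elt, neg_elt).  For p = 2,
    n = 64 v - 11 with empty top digits, the low digits lose one letter and the
    top digits gain one in both conjugations by a^+-1, and conjugation by t^+-1
    changes the length by -2 and +2: curvature zero.  Low digits of 64 v + 1
    gain instead of losing: negative curvature.  Adding to 64 v - 11 a digit at the
    final height k - p lets one of the conjugations by a^+-1 cancel that digit, at
    the price of at most one extra letter in the conjugate by t: positive
    curvature.

    It remains to see that the sparse blocks of total length N - d, whose number
    is growth (N - d), are a positive fraction of the sphere of radius N.  As
    growth (N + 1) <= 3 growth N, it suffices to bound the sphere by a multiple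
    of growth N (bs_card_sphere_le).  Up to inversion, an element with a word of
    length N is t^-p (a^n t^H) t^-j where p, j and the cost of the monotone part
    a^n t^H add up to at most N; the monotone parts of cost at most M number at
    most a multiple of growth M (size_codes), and since growth grows
    exponentially the sums over p and j only cost constant factors
    (size_shifts).  Upper bounds on the three densities are free because the
    three families are disjoint. *)

(** * Minimal signed binary expansions *)

(** Cheapest way of writing n with signed powers 2^0, ..., 2^h, each power
    costing 1.  Below the top only digits -1, 0, 1 are useful; all the rest goes
    to the top digit, which is why the base case is the absolute value. *)
Fixpoint naf (h : nat) (n : int) : nat :=
  if h is h'.+1 then
    if (2 %| n)%Z then naf h' (n %/ 2)%Z
    else (minn (naf h' (n %/ 2)%Z) (naf h' ((n %/ 2)%Z + 1))).+1
  else `|n|%N.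

Lemma int_even_odd (n : int) : {q | n = 2 * q} + {q | n = 2 * q + 1}.
Proof.
case: (boolP (2 %| n)%Z) => n2; [left | right]; exists (n %/ 2)%Z; lia.
Qed.

Lemma naf_double h q : naf h.+1 (2 * q) = naf h q.
Proof.
rewrite /=; have -> : (2 %| 2 * q)%Z by lia.
by congr naf; lia.
Qed.

Lemma naf_odd h q : naf h.+1 (2 * q + 1) = (minn (naf h q) (naf h (q + 1))).+1.
Proof.
rewrite /=; have /negbTE -> : ~~ (2 %| 2 * q + 1)%Z by lia.
by have -> : ((2 * q + 1) %/ 2)%Z = q by lia.
Qed.

Lemma naf_opp h n : naf h (- n) = naf h n.
Proof.
elim: h n => [|h IHh] n; first by rewrite /= abszN.
have [[q ->]|[q ->]] := int_even_odd n.
  by rewrite -mulrN !naf_double.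
have -> : - (2 * q + 1) = 2 * (- (q + 1)) + 1 by lia.
rewrite !naf_odd; have -> : - (q + 1) + 1 = - q by lia.
by rewrite !IHh minnC.
Qed.

(** One more signed power costs at most one more: this makes naf a lower bound
    for the number of letters a in a word, whatever expansion the word spells. *)
Lemma naf_addX h n i : (i <= h)%N -> (naf h (n + 2 ^+ i) <= (naf h n).+1)%N.
Proof.
elim: h n i => [|h IHh] n [|i] //= le_ih; try by rewrite expr0; lia.
  rewrite -!/(naf h.+1 _) expr0.
  have [[q ->]|[q ->]] := int_even_odd n.
    by rewrite naf_odd naf_double; lia.
  have -> : 2 * q + 1 + 1 = 2 * (q + 1) by lia.
  have := IHh q 0%N isT; rewrite naf_odd naf_double expr0; lia.
rewrite -!/(naf h.+1 _) exprS.
have [[q ->]|[q ->]] := int_even_odd n.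
  by rewrite -mulrDr !naf_double IHh.
have -> : 2 * q + 1 + 2 * 2 ^+ i = 2 * (q + 2 ^+ i) + 1 by lia.
rewrite !naf_odd; have := IHh q i le_ih; have := IHh (q + 1) i le_ih.
have -> : q + 1 + 2 ^+ i = q + 2 ^+ i + 1 by lia.
lia.
Qed.

Lemma naf_subX h n i : (i <= h)%N -> (naf h (n - 2 ^+ i) <= (naf h n).+1)%N.
Proof.
move=> le_ih; rewrite -naf_opp -(naf_opp h n).
have -> : - (n - 2 ^+ i) = - n + 2 ^+ i by lia.
exact: naf_addX.
Qed.

Lemma naf_geS h n : (naf h.+1 n <= naf h n)%N.
Proof.
elim: h n => [|h IHh] n; have [[q ->]|[q ->]] := int_even_odd n.
- rewrite naf_double /=; lia.
- rewrite naf_odd /=; lia.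
- by rewrite !naf_double.
rewrite !naf_odd; have := IHh q; have := IHh (q + 1); lia.
Qed.

(** Once |n| <= 2^h the top digit is too small for a further level to help. *)
Lemma naf_stable h n : (`|n| <= 2 ^ h)%N -> naf h.+1 n = naf h n.
Proof.
elim: h n => [|h IHh] n le_n; have [[q def_n]|[q def_n]] := int_even_odd n;
  rewrite {}def_n in le_n *.
- rewrite naf_double /=; lia.
- rewrite naf_odd /=; lia.
- by rewrite !naf_double IHh //; rewrite expnS in le_n; lia.
by rewrite !naf_odd !IHh //; rewrite expnS in le_n; lia.
Qed.

(** A digit +-1 followed by a digit 0 is always an optimal choice; this is the
    optimality of the non-adjacent form. *)
Lemma naf_4p1 h n : naf h.+2 (4 * n + 1) = (naf h n).+1.
Proof.
have -> : 4 * n + 1 = 2 * (2 * n) + 1 by lia.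
rewrite naf_odd naf_double naf_odd; congr S.
by have := @naf_subX h (n + 1) 0 isT; rewrite expr0 addrK; lia.
Qed.

Lemma naf_4m1 h n : naf h.+2 (4 * n - 1) = (naf h n).+1.
Proof.
rewrite -naf_opp -(naf_opp h n); have -> : - (4 * n - 1) = 4 * (- n) + 1 by lia.
exact: naf_4p1.
Qed.

(** The number of nonzero digits of the non-adjacent form: by [naf_stable] the
    height |n| is large enough to be no restriction. *)
Definition wt (n : int) : nat := naf `|n| n.

Lemma wtE h n : (`|n| <= 2 ^ h)%N -> wt n = naf h n.
Proof.
have stab j i : (`|n| <= 2 ^ i)%N -> naf (j + i) n = naf i n.
  move=> le_n; elim: j => // j IHj; rewrite addSn naf_stable //.
  by apply: leq_trans le_n _; rewrite leq_exp2l // leq_addl.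
have le_nn : (`|n| <= 2 ^ `|n|)%N by apply/ltnW/ltn_expl.
move=> le_nh; have [le_h|/ltnW le_h] := leqP `|n| h; rewrite /wt.
  by rewrite -(subnK le_h) stab.
by rewrite -(subnK le_h) stab.
Qed.

Lemma wt_le_naf h n : (wt n <= naf h n)%N.
Proof.
have [h1 le1 h2] : exists2 h1, (h <= h1)%N & (`|n| <= 2 ^ h1)%N.
  exists (h + `|n|)%N; first by rewrite leq_addr.
  by apply: leq_trans (ltnW (ltn_expl _ (ltnSn 1))) _; rewrite leq_exp2l // leq_addl.
rewrite (wtE h2) -(subnK le1); elim: (h1 - h)%N => // k IHk.
exact: leq_trans (naf_geS _ _) IHk.
Qed.

Lemma wt_opp n : wt (- n) = wt n.
Proof. by rewrite /wt abszN naf_opp. Qed.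

Lemma wt0 : wt 0 = 0%N. Proof. by []. Qed.

Lemma wt_addX n i : (wt (n + 2 ^+ i) <= (wt n).+1)%N.
Proof.
pose h := (`|n| + i)%N.
have le_n : (`|n| <= 2 ^ h)%N.
  by apply: leq_trans (ltnW (ltn_expl _ (ltnSn 1))) _; rewrite leq_exp2l // leq_addr.
rewrite (wtE le_n); apply: leq_trans (wt_le_naf h _) _.
by apply: naf_addX; apply: leq_addl.
Qed.

Lemma wt_subX n i : (wt (n - 2 ^+ i) <= (wt n).+1)%N.
Proof.
rewrite -wt_opp -(wt_opp n); have -> : - (n - 2 ^+ i) = - n + 2 ^+ i by lia.
exact: wt_addX.
Qed.

Lemma wt_double n : wt (2 * n) = wt n.
Proof.
have le_n : (`|n| <= 2 ^ `|n|)%N by apply/ltnW/ltn_expl.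
rewrite (wtE le_n) (@wtE `|n|.+1) ?naf_double // expnS; lia.
Qed.

Lemma wt_4p1 n : wt (4 * n + 1) = (wt n).+1.
Proof.
have le_n : (`|n| < 2 ^ `|n|)%N by apply/ltn_expl.
by rewrite (@wtE `|n|.+2) ?naf_4p1 // !expnS; lia.
Qed.

Lemma wt_4m1 n : wt (4 * n - 1) = (wt n).+1.
Proof.
rewrite -wt_opp -(wt_opp n); have -> : - (4 * n - 1) = 4 * (- n) + 1 by lia.
exact: wt_4p1.
Qed.

(** * The normal form t^-p a^n t^k *)

Section IntPower.
Context {G : groupType}.
Implicit Types (x : G) (m n : int).

Definition expgz x n : G :=
  match n with Posz k => x ^+ k | Negz k => x ^- k.+1 end%g.

Lemma expgz_nat x (k : nat) : expgz x k = (x ^+ k)%g. Proof. by []. Qed.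

Lemma expgz1 x : expgz x 1 = x. Proof. by []. Qed.

Lemma expgzS x n : expgz x (n + 1) = (x * expgz x n)%g.
Proof.
case: n => [k|[|k]]; rewrite addrC.
- by rewrite [LHS]/= add1n expgS.
- by rewrite /= expg0 expg1 mulgV.
have -> : 1 + Negz k.+1 = Negz k by lia.
by rewrite /= [in RHS]expgSr invgM mulVKg.
Qed.

Lemma expgzD x m n : expgz x (m + n) = (expgz x m * expgz x n)%g.
Proof.
elim/int_rect: m n => [|k IHk|k IHk] n; first by rewrite add0r mul1g.
  have -> : k.+1%:Z = k%:Z + 1 by lia.
  by rewrite addrAC !expgzS IHk mulgA.
apply: (@mulgI _ x); rewrite -expgzS mulgA -expgzS.
have -> : - k.+1%:Z + n + 1 = - k%:Z + n by lia.
by rewrite IHk; congr (expgz x _ * _)%g; lia.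
Qed.

Lemma expgzN x n : expgz x (- n) = ((expgz x n)^-1)%g.
Proof. by apply: (@mulgI _ (expgz x n)); rewrite -expgzD subrr mulgV. Qed.

End IntPower.

Section NormalForm.
Context {G : groupType} (t a : G) (rel_ta : (t * a * t^-1 = a ^+ 2)%g).

Lemma mul_t_expgz n : (t * expgz a n = expgz a (2 * n) * t)%g.
Proof.
have ta : (t * a = a ^+ 2 * t)%g by rewrite -rel_ta mulgVK.
have pos (k : nat) : (t * expgz a k = expgz a (2 * k%:Z) * t)%g.
  elim: k => [|k IHk]; first by rewrite mulr0 expgz_nat expg0 mulg1 mul1g.
  have -> : k.+1%:Z = k%:Z + 1 by lia.
  have -> : 2 * (k%:Z + 1) = 2 * k%:Z + 1 + 1 by lia.
  by rewrite !expgzS mulgA ta -!mulgA IHk.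
case: n => // k; rewrite NegzE mulrN !expgzN.
by apply: (@mulgI _ (expgz a (2 * k.+1%:Z))); rewrite mulVKg mulgA -pos mulgK.
Qed.

Definition nform (p : nat) (n : int) (k : nat) : G :=
  (t ^- p * expgz a n * t ^+ k)%g.

Lemma nform1 : nform 0 0 0 = 1%g.
Proof. by rewrite /nform expg0 invg1 !mulg1. Qed.

Lemma nformV p n k : ((nform p n k)^-1)%g = nform k (- n) p.
Proof. by rewrite /nform !invgM invgK expgzN mulgA. Qed.

Lemma nform_mul_t p n k : (nform p n k * t)%g = nform p n k.+1.
Proof. by rewrite /nform expgSr !mulgA. Qed.

Lemma nform_mul_tV p n k : (nform p n k.+1 * t^-1)%g = nform p n k.
Proof. by rewrite -nform_mul_t mulgK. Qed.

Lemma tV_mul_nform p n k : (t^-1 * nform p n k)%g = nform p.+1 n k.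
Proof. by rewrite /nform expgSr invgM !mulgA. Qed.

Lemma t_mul_nform p n k : (t * nform p.+1 n k)%g = nform p n k.
Proof. by rewrite -tV_mul_nform mulVKg. Qed.

Lemma t_mul_nform0 n k : (t * nform 0 n k)%g = nform 0 (2 * n) k.+1.
Proof.
by rewrite /nform expg0 invg1 !mul1g mulgA mul_t_expgz expgS mulgA.
Qed.

Lemma nform_mul_a p n k i : (nform p n k * expgz a i)%g = nform p (n + i * 2 ^+ k) k.
Proof.
have tk : (t ^+ k * expgz a i = expgz a (i * 2 ^+ k) * t ^+ k)%g.
  elim: k => [|k IHk]; first by rewrite expg0 mul1g mulg1 expr0 mulr1.
  rewrite expgS -mulgA IHk mulgA mul_t_expgz -mulgA; congr (expgz a _ * _)%g.
  by rewrite exprS; lia.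
by rewrite /nform -mulgA tk !mulgA -(mulgA _ (expgz a n)) -expgzD.
Qed.

Lemma a_mul_nform p n k i : (expgz a i * nform p n k)%g = nform p (n + i * 2 ^+ p) k.
Proof.
apply: invg_inj; rewrite invgM -expgzN !nformV nform_mul_a; congr nform; lia.
Qed.

End NormalForm.

Local Notation bs_nf := (nform bs_t bs_a).

(** * Upper bounds for the word length *)

Lemma word_length_le w : (word_length (bs_class w) <= size w)%N.
Proof.
rewrite /word_length; case: ex_minnP => m _; apply; apply/asboolP.
by exists w.
Qed.

Lemma word_lengthP g : exists2 w, size w = word_length g & bs_class w = g.
Proof. by rewrite /word_length; case: ex_minnP => m /asboolP[w sw <-] _; exists w. Qed.

Lemma word_lengthM g h : (word_length (g * h)%g <= word_length g + word_length h)%N.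
Proof.
have [u <- <-] := word_lengthP g; have [v <- <-] := word_lengthP h.
by rewrite -bs_classM -size_cat word_length_le.
Qed.

Lemma word_lengthV g : (word_length (g^-1)%g = word_length g).
Proof.
have le h : (word_length (h^-1)%g <= word_length h)%N.
  have [u <- <-] := word_lengthP h; rewrite -bs_classV.
  by rewrite -[X in (_ <= X)%N](size_map letter_inv) -size_rev word_length_le.
by apply/eqP; rewrite eqn_leq le -{1}[g]invgK le.
Qed.

Lemma word_length1 : word_length 1%g = 0%N.
Proof. by apply/eqP; rewrite -leqn0 (word_length_le [::]). Qed.

Lemma word_length_a : (word_length bs_a <= 1)%N.
Proof. exact: (word_length_le [:: letter_a]). Qed.
Lemma word_length_t : (word_length bs_t <= 1)%N.
Proof. exact: (word_length_le [:: letter_t]). Qed.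

Lemma word_lengthX g k : (word_length g <= 1)%N -> (word_length (g ^+ k)%g <= k)%N.
Proof.
move=> g1; elim: k => [|k IHk]; first by rewrite expg0 word_length1.
by rewrite expgS; apply: leq_trans (word_lengthM _ _) (leq_add g1 IHk).
Qed.

Lemma word_length_expgz n : (word_length (expgz bs_a n) <= `|n|)%N.
Proof.
by case: n => k /=; rewrite ?NegzE ?abszN ?word_lengthV;
   apply: word_lengthX word_length_a.
Qed.

(** Climb k levels and drop on the way the digits of an optimal expansion. *)
Lemma word_length_expgz_t n k :
  (word_length (expgz bs_a n * bs_t ^+ k)%g <= k + naf k n)%N.
Proof.
elim: k n => [|k IHk] n; first by rewrite expg0 mulg1 word_length_expgz.
have dbl q : (word_length (expgz bs_a (2 * q) * bs_t ^+ k.+1)%g <= k.+1 + naf k q)%N.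
  rewrite expgS mulgA -(mul_t_expgz BS12_relation) -mulgA.
  apply: leq_trans (word_lengthM _ _) _.
  by rewrite -add1n -addnA leq_add ?word_length_t.
have [[q ->]|[q ->]] := int_even_odd n; first by rewrite naf_double dbl.
rewrite naf_odd; have := word_length_a; set A := bs_a => A1.
have h1 : (word_length (expgz bs_a (2 * q + 1) * bs_t ^+ k.+1)%g <= k.+1 + naf k q + 1)%N.
  rewrite expgzS -mulgA; apply: leq_trans (word_lengthM _ _) _.
  by rewrite addnC leq_add.
have h2 : (word_length (expgz bs_a (2 * q + 1) * bs_t ^+ k.+1)%g
    <= k.+1 + naf k (q + 1) + 1)%N.
  have -> : 2 * q + 1 = - 1 + 2 * (q + 1) by lia.
  rewrite expgzD -mulgA; apply: leq_trans (word_lengthM _ _) _.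
  by rewrite addnC leq_add // word_lengthV.
by rewrite /minn addnS -[(_ + _).+1]addn1; case: ifP.
Qed.

Lemma word_length_nf_le p n k : (word_length (bs_nf p n k) <= p + k + naf k n)%N.
Proof.
rewrite /nform -mulgA; apply: leq_trans (word_lengthM _ _) _.
rewrite word_lengthV -addnA leq_add ?word_length_expgz_t //.
exact: word_lengthX word_length_t.
Qed.

(** * Lower bounds for the word length *)

(** The state (n, p, m) stands for the affine map with translation part n / 2^p
    and dilation 2^m; letters act by left multiplication. *)
Definition state : Type := (int * nat * int)%type.
Definition letter_act (x : letter) (s : state) : state :=
  let: (n, p, m) := s in
  match x with
  | (false, false) => (n + 2 ^+ p, p, m)
  | (false, true) => (n - 2 ^+ p, p, m)
  | (true, false) => if p is p'.+1 then (n, p', m + 1) else (2 * n, 0%N, m + 1)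
  | (true, true) => if (p == 0%N) && (2 %| n)%Z then ((n %/ 2)%Z, 0%N, m - 1)
                    else (n, p.+1, m - 1)
  end.
(** Reducedness makes the representation of n / 2^p unique, so that the defining
    relations hold strictly and the action descends to the group. *)
Definition reduced (s : state) : bool := (s.1.2 == 0%N) || ~~ (2 %| s.1.1)%Z.
Definition act (w : word) (s : state) : state := foldr letter_act s w.

Lemma act_cat u v s : act (u ++ v) s = act u (act v s).
Proof. exact: foldr_cat. Qed.

Lemma letter_act_reduced x s : reduced s -> reduced (letter_act x s).
Proof.
case: x s => [[] []] [[n p] m] //; rewrite /reduced /=.
- by case: p => [|p] //=; case: (boolP (2 %| n)%Z).
- by case: p => [|p] //= ->; rewrite orbT.
all: case: p => [|p] //=; rewrite exprS; lia.
Qed.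

Lemma act_reduced w s : reduced s -> reduced (act w s).
Proof. by move=> rs; elim: w => //= x w; apply: letter_act_reduced. Qed.

Lemma letter_actK x s : reduced s -> letter_act x (letter_act (letter_inv x) s) = s.
Proof.
case: x s => [[] []] [[n p] m]; rewrite /letter_act /letter_inv /reduced /=.
- case: p => [|p] /=.
    have -> : (2 %| 2 * n)%Z by lia.
    by move=> _; congr (_, _, _); lia.
  by case: p => [|p] /= n2; rewrite ?(negbTE n2) ?addrK.
- by case: ifP => [/andP[/eqP-> n2]|_] _; congr (_, _, _); lia.
- by rewrite addrK.
by rewrite subrK.
Qed.

Lemma act_bs_eq u v : bs_eq u v -> forall s, reduced s -> act u s = act v s.
Proof.
elim=> {u v} [//|u v _ IH s rs|u v w _ IH1 _ IH2 s rs|u u' v v' _ IH1 _ IH2 s rs|x s rs|].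
- by rewrite IH.
- by rewrite IH1 ?IH2.
- by rewrite !act_cat IH2 // IH1 // act_reduced.
- by rewrite /act /= letter_actK.
case=> [[n p] m] rs; rewrite /act /=.
case: ifP => [/andP[/eqP-> n2]|_]; rewrite /= ?exprS ?expr0; congr (_, _, _); lia.
Qed.

Definition state0 : state := (0, 0%N, 0).
Definition bs_state (g : BS12) : state := act (repr g) state0.

Lemma bs_state_class w : bs_state (bs_class w) = act w state0.
Proof. by apply: act_bs_eq => //; apply: bs_eq_repr. Qed.

Lemma bs_stateM w g : bs_state (bs_class w * g)%g = act w (bs_state g).
Proof. by rewrite -[g]bs_class_repr -bs_classM !bs_state_class act_cat. Qed.

(** A walk from height 0 to height m through height -p has at least
    p + |m + p| steps. *)
Definition cost (s : state) : nat :=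
  let: (n, p, m) := s in (wt n + p + `|(m + p%:Z)%R|)%N.

Lemma cost_letter x s : (cost (letter_act x s) <= (cost s).+1)%N.
Proof.
case: x s => [[] []] [[n p] m] /=.
- case: ifP => [/andP[/eqP-> n2]|_] /=; last by lia.
  rewrite -(wt_double (n %/ 2)%Z).
  have -> : 2 * (n %/ 2)%Z = n by lia.
  lia.
- by case: p => [|p] /=; rewrite ?wt_double; lia.
- by rewrite -!addSn !leq_add2r wt_subX.
by rewrite -!addSn !leq_add2r wt_addX.
Qed.

Lemma cost_le_word_length g : (cost (bs_state g) <= word_length g)%N.
Proof.
have [w <- <-] := word_lengthP g; rewrite bs_state_class.
by elim: w => //= x w IHw; apply: leq_trans (cost_letter _ _) _.
Qed.

Lemma bs_classVa : bs_class [:: (false, true)] = (bs_a^-1)%g.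
Proof. by rewrite -bs_classV. Qed.
Lemma bs_classVt : bs_class [:: (true, true)] = (bs_t^-1)%g.
Proof. by rewrite -bs_classV. Qed.

Lemma bs_state_expgz i g n p m : bs_state g = (n, p, m) ->
  bs_state (expgz bs_a i * g)%g = (n + i * 2 ^+ p, p, m).
Proof.
move=> sg; elim/int_rect: i => [|i IHi|i IHi].
- by rewrite mul1g mul0r addr0.
- have -> : i.+1%:Z = i%:Z + 1 by lia.
  rewrite expgzS -mulgA (bs_stateM [:: letter_a]) IHi /=; congr (_, _, _); lia.
have -> : - i.+1%:Z = - 1 + - i%:Z by lia.
rewrite expgzD -mulgA (expgzN _ 1) expgz1 -bs_classVa bs_stateM IHi /=.
by congr (_, _, _); lia.
Qed.

Lemma bs_state_nf p n k : reduced (n, p, 0) ->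
  bs_state (bs_nf p n k) = (n, p, k%:Z - p%:Z).
Proof.
have st_t : bs_state (bs_t ^+ k)%g = (0, 0%N, k%:Z).
  elim: k => [|k IHk]; first by rewrite expg0 bs_state_class.
  by rewrite expgS (bs_stateM [:: letter_t]) IHk /=; congr (_, _, _); lia.
have st_a : bs_state (bs_nf 0 n k) = (n, 0%N, k%:Z).
  by rewrite /nform expg0 invg1 mul1g (bs_state_expgz _ st_t) expr0 mulr1 add0r.
elim: p => [|p IHp] /=; first by rewrite st_a subr0.
rewrite /reduced /= => n2.
rewrite -tV_mul_nform -bs_classVt bs_stateM IHp /reduced /= ?n2 ?orbT //.
by rewrite (negbTE n2) andbF; congr (_, _, _); lia.
Qed.

(** [cost] vanishes at the identity and grows by at most one per letter. *)
Lemma word_length_nf_ge p n k : reduced (n, p, 0) ->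
  (p + k + wt n <= word_length (bs_nf p n k))%N.
Proof.
move=> rn; apply: leq_trans (cost_le_word_length _).
rewrite bs_state_nf //=; lia.
Qed.

(** If the top digit of an optimal expansion of n is not too high, the range of
    the shortest possible walk accommodates the whole expansion. *)
Lemma word_length_nf p n k : reduced (n, p, 0) -> (`|n| <= 2 ^ k)%N ->
  word_length (bs_nf p n k) = (p + k + wt n)%N.
Proof.
move=> rn le_n; apply/eqP; rewrite eqn_leq word_length_nf_ge // andbT.
by rewrite (wtE le_n) word_length_nf_le.
Qed.

(** * Sparse expansions and their growth *)

(** Pairs (n, h) stand for monotone words with translation part n and h letters
    t, built up from base pairs by prepending t (cost 1) or a^+-1 t t (cost 3),
    that is, by prepending a digit 0, or a digit +-1 and a digit 0.  The base
    [B N] contributes pairs at cost N; both the lower and the upper bound for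
    spheres use this recursion, with different bases. *)
Fixpoint grow (B : nat -> seq (int * nat)) (N : nat) : seq (int * nat) :=
  B N ++
  if N is N1.+1 then
    [seq (2 * c.1, c.2.+1) | c <- grow B N1] ++
    if N1 is N2.+2 then
      [seq (4 * c.1 + 1, c.2.+2) | c <- grow B N2] ++
      [seq (4 * c.1 - 1, c.2.+2) | c <- grow B N2]
    else [::]
  else [::].

Lemma grow_base B N : {subset B N <= grow B N}.
Proof. by move=> c cN; case: N cN => [|N] cN /=; rewrite mem_cat cN. Qed.

Lemma growS B N : {subset [seq (2 * c.1, c.2.+1) | c <- grow B N] <= grow B N.+1}.
Proof. by move=> c cN /=; rewrite !mem_cat cN !orbT. Qed.

Lemma grow_p1 B N : {subset [seq (4 * c.1 + 1, c.2.+2) | c <- grow B N] <= grow B N.+3}.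
Proof. by move=> c cN; rewrite [grow _ _]/= !mem_cat cN !orbT. Qed.

Lemma grow_m1 B N : {subset [seq (4 * c.1 - 1, c.2.+2) | c <- grow B N] <= grow B N.+3}.
Proof. by move=> c cN; rewrite [grow _ _]/= !mem_cat cN !orbT. Qed.

Lemma size_grow B N :
  size (grow B N.+3) = (size (B N.+3) + size (grow B N.+2) + 2 * size (grow B N))%N.
Proof.
have -> : grow B N.+3 = B N.+3 ++ [seq (2 * c.1, c.2.+1) | c <- grow B N.+2] ++
    [seq (4 * c.1 + 1, c.2.+2) | c <- grow B N] ++
    [seq (4 * c.1 - 1, c.2.+2) | c <- grow B N] by [].
by rewrite 3!size_cat 3!size_map mul2n -addnn addnA.
Qed.

Definition sparse := grow (fun N => if N is 0%N then [:: (0, 0%N)] else [::]).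
Definition growth (N : nat) : nat := size (sparse N).

Lemma sparse_ind (P : nat -> int -> nat -> Prop) :
  P 0%N 0 0%N ->
  (forall N v h, P N v h -> P N.+1 (2 * v) h.+1) ->
  (forall N v h, P N v h -> P N.+3 (4 * v + 1) h.+2) ->
  (forall N v h, P N v h -> P N.+3 (4 * v - 1) h.+2) ->
  forall N c, c \in sparse N -> P N c.1 c.2.
Proof.
move=> P0 P1 Pp Pm N; elim/ltn_ind: N => -[|N] IHN c.
  by rewrite /sparse /= inE => /eqP->.
rewrite /sparse [grow _ _]/= !mem_cat => /orP[|].
  by case/mapP=> d dN -> /=; apply/P1/IHN.
case: N IHN => [|[|N]] IHN //=; rewrite mem_cat => /orP[] /mapP[d dN ->] /=.
  by apply/Pp/IHN => //; rewrite ltnW // ltnW.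
by apply/Pm/IHN => //; rewrite ltnW // ltnW.
Qed.

Lemma sparse_cost N c : c \in sparse N -> N = (c.2 + wt c.1)%N.
Proof.
move: N c; apply: (sparse_ind (P := fun N v h => N = h + wt v)%N);
  rewrite ?wt0 // => N v h ->; rewrite ?wt_double ?wt_4p1 ?wt_4m1; lia.
Qed.

Lemma sparse_lt N c : c \in sparse N -> (`|c.1| < 2 ^ c.2)%N.
Proof.
move: N c; apply: (sparse_ind (P := fun _ v h => `|v| < 2 ^ h)%N) => // N v h;
  rewrite !expnS; lia.
Qed.

(** The digits at heights h - 1 and h of a sparse expansion of height h are 0, so
    a new digit at height h + 1 is not adjacent to another one. *)
Lemma sparse_wt_addX N c : c \in sparse N -> wt (c.1 + 2 ^+ c.2.+1) = (wt c.1).+1.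
Proof.
move: N c.
apply: (sparse_ind (P := fun _ v h => wt (v + 2 ^+ h.+1) = (wt v).+1)) => // N v h IH.
- by rewrite exprS -mulrDr !wt_double.
- have -> : 4 * v + 1 + 2 ^+ h.+3 = 4 * (v + 2 ^+ h.+1) + 1 by rewrite !exprS; lia.
  by rewrite !wt_4p1 IH.
have -> : 4 * v - 1 + 2 ^+ h.+3 = 4 * (v + 2 ^+ h.+1) - 1 by rewrite !exprS; lia.
by rewrite !wt_4m1 IH.
Qed.

Lemma sparse_opp N c : c \in sparse N -> (- c.1, c.2) \in sparse N.
Proof.
move: N c.
apply: (sparse_ind (P := fun N v h => (- v, h) \in sparse N)) => // N v h IH.
- by apply: growS; apply/mapP; exists (- v, h) => //=; rewrite mulrN.
- by apply: grow_m1; apply/mapP; exists (- v, h) => //=; congr (_, _); lia.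
by apply: grow_p1; apply/mapP; exists (- v, h) => //=; congr (_, _); lia.
Qed.

Lemma sparse_wt_subX N c : c \in sparse N -> wt (c.1 - 2 ^+ c.2.+1) = (wt c.1).+1.
Proof.
move=> /sparse_opp /sparse_wt_addX /= IH.
by rewrite -(wt_opp c.1) -IH -wt_opp; congr wt; lia.
Qed.

Lemma sparse_uniq N : uniq (sparse N).
Proof.
elim/ltn_ind: N => -[//|N] IHN; rewrite /sparse [grow _ _]/= cat_uniq.
rewrite map_inj_uniq ?IHN //; last by move=> [v h] [v' h'] /= [] *; congr (_, _); lia.
case: N IHN => [|[|N]] IHN //=; have uN : uniq (sparse N) by rewrite IHN // ltnW // ltnW.
rewrite cat_uniq !map_inj_uniq ?uN;
  try by move=> [v h] [v' h'] /= [] *; congr (_, _); lia.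
rewrite /= andbT; apply/andP; split; apply/hasPn => c.
  by rewrite mem_cat => /orP[] /mapP[d _ ->]; apply/mapP => -[e _ []]; lia.
by move=> /mapP[d _ ->]; apply/mapP => -[e _ []]; lia.
Qed.

Lemma growth_rec N : growth N.+3 = (growth N.+2 + 2 * growth N)%N.
Proof. by rewrite /growth /sparse size_grow. Qed.

Lemma growth_monoS N : (growth N <= growth N.+1)%N.
Proof.
elim/ltn_ind: N => -[|[|N]] IHN //; rewrite growth_rec; lia.
Qed.

Lemma growth_gt0 N : (0 < growth N)%N.
Proof. by elim: N => // N IHN; apply: leq_trans IHN (growth_monoS N). Qed.

Lemma growthS_le N : (growth N.+1 <= 3 * growth N)%N.
Proof.
case: N => [|[|N]] //; rewrite growth_rec.
have := growth_monoS N; have := growth_monoS N.+1; lia.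
Qed.

Lemma growth_addn_le k N : (growth (N + k) <= 3 ^ k * growth N)%N.
Proof.
elim: k => [|k IHk]; first by rewrite addn0 mul1n.
rewrite addnS expnS -mulnA; apply: leq_trans (growthS_le _) _.
by rewrite leq_pmul2l.
Qed.

(** Exponential growth in steps of three, enough for convergence of the sums in
    [size_shifts]. *)
Lemma growth_tripling N : (3 * growth N <= growth N.+3)%N.
Proof.
rewrite growth_rec; have := growth_monoS N; have := growth_monoS N.+1; lia.
Qed.

(** * Spheres are not larger than a multiple of the growth of sparse expansions *)

(** Bases for optimal expansions with unlimited top digit: the height is 0 or 1
    because the digit below the top need not be followed by a digit 0. *)
Definition top_codes (N : nat) : seq (int * nat) :=
  [seq (i%:Z - (2 * N)%:Z, e) | i <- iota 0 (4 * N).+1, e <- [:: 0%N; 1%N]].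

Lemma mem_top_codes N n e : (`|n| <= 2 * N)%N -> (e < 2)%N -> (n, e) \in top_codes N.
Proof.
move=> le_n lt_e; apply/allpairsP.
exists (`|(n + (2 * N)%:Z)%R|%N, e); rewrite mem_iota; split => /=.
- lia.
- rewrite !inE; lia.
by congr (_, _); lia.
Qed.

(** Reading the digits from the bottom, an odd number is 4 r + 1 or 4 r - 1, and
    [naf_4p1] and [naf_4m1] say that the corresponding sparse step is optimal. *)
Lemma codes_complete H n N : (naf H n + H <= N)%N -> (n, H) \in grow top_codes N.
Proof.
have base M m e : (`|m| <= 2 * M)%N -> (e < 2)%N -> (m, e) \in grow top_codes M.
  by move=> mM e2; apply/grow_base/mem_top_codes.
elim/ltn_ind: H n N => -[|[|H]] IHH n N leN.
- by apply: base => //; move: leN => /=; lia.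
- apply: base => //; have [[q def_n]|[q def_n]] := int_even_odd n;
    move: leN; rewrite def_n ?naf_double ?naf_odd /=; lia.
have [[q def_n]|[q def_n]] := int_even_odd n; rewrite {}def_n in leN *.
  case: N leN => [|N]; rewrite naf_double => leN; first lia.
  apply: growS; apply/mapP; exists (q, H.+1) => //; apply: IHH => //; lia.
have [[r def_q]|[r def_q]] := int_even_odd q; rewrite {}def_q in leN *.
  have e4 : 2 * (2 * r) + 1 = 4 * r + 1 by lia.
  rewrite e4 naf_4p1 in leN *.
  case: N leN => [|[|[|N]]] leN; try lia.
  by apply: grow_p1; apply/mapP; exists (r, H) => //; apply: IHH; lia.
have e4 : 2 * (2 * r + 1) + 1 = 4 * (r + 1) - 1 by lia.
rewrite e4 naf_4m1 in leN *.
case: N leN => [|[|[|N]]] leN; try lia.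
by apply: grow_m1; apply/mapP; exists (r + 1, H) => //; apply: IHH; lia.
Qed.

(** The bases have linear size, which does not affect exponential growth; the
    linear terms in the proof absorb it in the induction. *)
Lemma size_codes N : (size (grow top_codes N) <= 60 * growth N)%N.
Proof.
pose d n := size (grow top_codes n).
have szB n : size (top_codes n) = (8 * n + 2)%N.
  by rewrite size_allpairs size_iota /=; lia.
suff: (d N + 4 * N + 15 <= 60 * growth N)%N by rewrite /d; lia.
elim/ltn_ind: N => -[|[|[|N]]] IHN //.
rewrite growth_rec {1}/d size_grow szB -/(d N) -/(d N.+2).
have := IHN N; have := IHN N.+2 (ltnSn _); lia.
Qed.

(** [shifts N] lists the j-th iterates of f on the members of X (N - j). *)
Section Shifts.
Context {T : eqType} (f : T -> T) (X : nat -> seq T).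

Fixpoint shifts (N : nat) : seq T :=
  X N ++ if N is N'.+1 then [seq f x | x <- shifts N'] else [::].

Lemma mem_shifts j N x : x \in X N -> iter j f x \in shifts (j + N).
Proof.
move=> xN; elim: j => [|j IHj].
  by case: (N) xN => [|M] xM /=; rewrite mem_cat xM.
by rewrite addSn /= mem_cat map_f ?orbT.
Qed.

(** A geometric sum: by [growth_tripling], splitting off three terms leaves one
    third of the bound, and the factor 5 works because 3 + 5 / 3 <= 5. *)
Lemma size_shifts C : (forall N, size (X N) <= C * growth N)%N ->
  forall N, (size (shifts N) <= 5 * C * growth N)%N.
Proof.
move=> szX N; elim/ltn_ind: N => -[|[|[|N]]] IHN /=; rewrite ?(size_cat, size_map).
- by have := szX 0%N; rewrite /growth /= !muln1; lia.
- by have := szX 1%N; have := szX 0%N; rewrite /growth /= !muln1; lia.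
- by have := szX 2%N; have := szX 1%N; have := szX 0%N; rewrite /growth /= !muln1; lia.
have := growth_tripling N; have := growth_monoS N.+1; have := growth_monoS N.+2.
have := szX N.+3; have := szX N.+2; have := szX N.+1; have := IHN N; nia.
Qed.

End Shifts.

(** Here -p and H - p bound the heights visited by the walk of w.  Such a walk,
    ending at height k - p, has at least 2 H - |k - p| letters t, and its letters
    a sit at the heights whose digits [naf H] may use. *)
Lemma word_profile w : exists p n k H,
  [/\ bs_class w = bs_nf p n k, (p <= H)%N, (k <= H)%N &
      (naf H n + 2 * H <= size w + `|k%:Z - p%:Z|)%N].
Proof.
elim: w => [|x w [p [n [k [H [Ew lepH lekH szw]]]]]].
  by exists 0%N, 0, 0%N, 0%N; rewrite nform1.
rewrite -cat1s bs_classM Ew {Ew}; case: x => [[] []].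
- rewrite bs_classVt tV_mul_nform; have [lt_pH|le_Hp] := ltnP p H.
    by exists p.+1, n, k, H; split => //; rewrite /=; lia.
  exists p.+1, n, k, H.+1; split => //; first by rewrite ltnW.
  by have := naf_geS H n; rewrite [size _]/=; lia.
- rewrite -[bs_class _]/bs_t; case: p lepH szw => [|p] lepH szw.
    rewrite (t_mul_nform0 BS12_relation); exists 0%N, (2 * n), k.+1, H.+1.
    by split=> //; rewrite naf_double [size _]/=; lia.
  rewrite t_mul_nform; exists p, n, k, H; split => //; first exact: ltnW.
  by rewrite /=; lia.
- have -> : bs_class [:: (false, true)] = expgz bs_a (- 1).
    by rewrite (expgzN _ 1) bs_classVa.
  exists p, (n - 2 ^+ p), k, H; split => //.
    by rewrite (a_mul_nform BS12_relation) mulN1r.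
  apply: (@leq_trans ((naf H n).+1 + 2 * H)); first by rewrite leq_add2r naf_subX.
  by rewrite [size _]/=; lia.
rewrite -[bs_class _]/(expgz bs_a 1).
exists p, (n + 2 ^+ p), k, H; split => //.
  by rewrite (a_mul_nform BS12_relation) mul1r.
apply: (@leq_trans ((naf H n).+1 + 2 * H)); first by rewrite leq_add2r naf_addX.
  by rewrite [size _]/=; lia.
Qed.

(** Elements t^-p (a^n t^H) t^-j of total cost at most N. *)
Definition ascents : nat -> seq BS12 :=
  shifts (fun g => g * bs_t^-1)%g (shifts (fun g => bs_t^-1 * g)%g
    (fun N => [seq bs_nf 0 c.1 c.2 | c <- grow top_codes N])).

Lemma mem_ascents p n k H N : (p <= k)%N -> (k <= H)%N ->
  (naf H n + 2 * H + p <= N + k)%N -> bs_nf p n k \in ascents N.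
Proof.
move=> lepk lekH leN; pose M := (N - (H - k) - p)%N.
have -> : N = ((H - k) + (p + M))%N by rewrite /M; lia.
have <- : iter (H - k) (fun g => g * bs_t^-1)%g (bs_nf p n H) = bs_nf p n k.
  rewrite -{2}(subnK lekH); elim: (H - k)%N => // j IHj.
  by rewrite iterSr addSn nform_mul_tV.
have <- : iter p (fun g => bs_t^-1 * g)%g (bs_nf 0 n H) = bs_nf p n H.
  by elim: (p) => //= j ->; rewrite tV_mul_nform.
do 2 apply: mem_shifts; apply/mapP; exists (n, H) => //.
by apply: codes_complete; rewrite /M; lia.
Qed.

Lemma size_ascents N : (size (ascents N) <= 1500 * growth N)%N.
Proof.
apply: (@size_shifts _ _ _ 300) => {}N; apply: (@size_shifts _ _ _ 60) => {}N.
by rewrite size_map size_codes.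
Qed.

(** Elements of negative final height are inverses of elements of positive one. *)
Lemma sphere_sub N :
  sphere N `<=` [set` ascents N ++ [seq (g^-1)%g | g <- ascents N]].
Proof.
move=> g; rewrite /sphere /= => <-; have [w <- <-] := word_lengthP g.
have [p [n [k [H [-> lepH lekH szw]]]]] := word_profile w.
rewrite mem_cat; apply/orP; have [lepk|ltkp] := leqP p k; [left | right].
  by apply: (mem_ascents lepk lekH); lia.
apply/mapP; exists (bs_nf k (- n) p); last by rewrite nformV opprK.
by apply: (mem_ascents (ltnW ltkp) lepH); rewrite naf_opp; lia.
Qed.

Lemma bs_card_le (A : set BS12) (s : seq BS12) :
  A `<=` [set` s] -> (bs_card A <= size s)%N.
Proof.
move=> As; have finA : finite_set A by apply: sub_finite_set As _; apply: finite_seq.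
apply: leq_trans (_ : #|` [fset x in s]%fset | <= _)%N.
  apply: fsubset_leq_card; apply/fsubsetP => x.
  by rewrite in_fset_set // inE => /As; rewrite !inE.
by rewrite card_fseq size_undup.
Qed.

Lemma bs_card_ge (A : set BS12) (s : seq BS12) : finite_set A -> uniq s ->
  [set` s] `<=` A -> (size s <= bs_card A)%N.
Proof.
move=> finA us sA; rewrite -(undup_id us) -card_fseq.
apply: fsubset_leq_card; apply/fsubsetP => x.
by rewrite !inE in_fset_set // inE => /sA.
Qed.

Lemma bs_card_sphere_le N : (bs_card (sphere N) <= 3000 * growth N)%N.
Proof.
apply: leq_trans (bs_card_le (@sphere_sub N)) _.
rewrite size_cat size_map.
by apply: leq_trans (leq_add (size_ascents N) (size_ascents N)) _; lia.
Qed.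

Lemma bs_nf_inj n n' p p' k k' : reduced (n, p, 0) -> reduced (n', p', 0) ->
  bs_nf p n k = bs_nf p' n' k' -> [/\ p = p', n = n' & k = k'].
Proof.
move=> rn rn' /(congr1 bs_state); rewrite !bs_state_nf // => -[-> ->] /addIr[->].
by split.
Qed.

(** * Conjugation curvature at radius one *)

Lemma conj_a p n k :
  (bs_a * bs_nf p n k * bs_a^-1)%g = bs_nf p (n + 2 ^+ p - 2 ^+ k) k.
Proof.
rewrite -[(bs_a^-1)%g](expgzN bs_a 1) -{1}[bs_a](expgz1 bs_a).
rewrite (a_mul_nform BS12_relation) (nform_mul_a BS12_relation).
by rewrite mul1r mulN1r.
Qed.

Lemma conj_aV p n k :
  (bs_a^-1 * bs_nf p n k * bs_a)%g = bs_nf p (n - 2 ^+ p + 2 ^+ k) k.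
Proof.
rewrite -[(bs_a^-1)%g](expgzN bs_a 1) -[in X in (_ * X)%g](expgz1 bs_a).
rewrite (a_mul_nform BS12_relation) (nform_mul_a BS12_relation).
by rewrite mul1r mulN1r.
Qed.

Lemma conj_t p n k : (bs_t * bs_nf p.+1 n k.+1 * bs_t^-1)%g = bs_nf p n k.
Proof. by rewrite t_mul_nform nform_mul_tV. Qed.

Lemma conj_tV p n k : (bs_t^-1 * bs_nf p n k * bs_t)%g = bs_nf p.+1 n k.+1.
Proof. by rewrite tV_mul_nform nform_mul_t. Qed.

Lemma word_length_eq0 g : word_length g = 0%N -> g = 1%g.
Proof. by have [[|x w] <- <-] := word_lengthP g. Qed.

Definition generators : seq BS12 := [:: bs_a; bs_a^-1; bs_t; bs_t^-1]%g.

(** States separate the four generators from each other and from the identity. *)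
Lemma generators_state : map bs_state generators =
  [:: (1, 0%N, 0); (-1, 0%N, 0); (0, 0%N, 1); (0, 0%N, -1)].
Proof.
rewrite /= -bs_classVa -bs_classVt (bs_state_class [:: letter_a]).
by rewrite (bs_state_class [:: letter_t]) !bs_state_class.
Qed.

Lemma generators_uniq : uniq generators.
Proof. by apply: (@map_uniq _ _ bs_state); rewrite generators_state. Qed.

Lemma sphere1E : sphere 1 = [set` generators].
Proof.
apply/seteqP; split=> g.
  rewrite /sphere /= => g1; have [w sw <-] := word_lengthP g.
  case: w sw => [|x [|]]; rewrite g1 //= !inE => _.
  by case: x => [[] []]; rewrite ?bs_classVa ?bs_classVt eqxx ?orbT.
move=> gG; have : bs_state g \in map bs_state generators by apply: map_f.
have gle : (word_length g <= 1)%N.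
  move: gG; rewrite /= !inE => /or4P[] /eqP->;
  by rewrite ?word_lengthV ?word_length_a ?word_length_t.
rewrite generators_state /sphere /=.
case: (posnP (word_length g)) => [/word_length_eq0 ->|].
  by rewrite (bs_state_class [::]).
by case: word_length gle => [|[]].
Qed.

Definition conj_sum (g : BS12) : nat :=
  (word_length (bs_a * g * bs_a^-1)%g + word_length (bs_a^-1 * g * bs_a)%g
   + word_length (bs_t * g * bs_t^-1)%g + word_length (bs_t^-1 * g * bs_t)%g)%N.

Lemma conj_curvature1E (R : realType) g : (0 < word_length g)%N ->
  conj_curvature R 1 g = ((4 * word_length g)%:R - (conj_sum g)%:R)
                         / (4 * word_length g)%:R.
Proof.
move=> g0; rewrite /conj_curvature sphere1E -fsbig_seq ?generators_uniq //.
have -> : bs_card [set` generators] = 4%N.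
  apply/eqP; rewrite eqn_leq (@bs_card_le _ generators) //.
  by rewrite (@bs_card_ge _ generators) ?generators_uniq //; exact: finite_seq.
rewrite /generators !big_cons big_nil /= addr0 !invgK natrM /conj_sum 3!natrD.
set l := (word_length g)%:R : R; have l0 : l != 0 by rewrite pnatr_eq0 -lt0n.
by field.
Qed.

Section Signs.
Context (R : realType) (g : BS12) (g0 : (0 < word_length g)%N).

Lemma conj_curvature1_gt0 : (conj_sum g < 4 * word_length g)%N ->
  0 < conj_curvature R 1 g.
Proof.
move=> lt; rewrite conj_curvature1E // divr_gt0 ?subr_gt0 ?ltr_nat //.
by rewrite ltr0n muln_gt0.
Qed.

Lemma conj_curvature1_lt0 : (4 * word_length g < conj_sum g)%N ->
  conj_curvature R 1 g < 0.
Proof.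
move=> lt; rewrite conj_curvature1E // pmulr_llt0 ?subr_lt0 ?ltr_nat //.
by rewrite invr_gt0 ltr0n muln_gt0.
Qed.

Lemma conj_curvature1_eq0 : conj_sum g = (4 * word_length g)%N ->
  conj_curvature R 1 g = 0.
Proof. by move=> eqs; rewrite conj_curvature1E // eqs subrr mul0r. Qed.

End Signs.

(** * Elements of prescribed curvature *)

(** Even when m exceeds 2^k, an isolated digit at height k costs a single letter. *)
Lemma word_length_nf_overflow (p k : nat) (n : int) m :
  reduced (m, p, 0) -> (`|n| <= 2 ^ k)%N -> wt m = (wt n).+1 ->
  m = n + 2 ^+ k \/ m = n - 2 ^+ k ->
  word_length (bs_nf p m k) = (p + k + (wt n).+1)%N.
Proof.
move=> rm le_n wm m_n; apply/eqP; rewrite eqn_leq -{2}wm word_length_nf_ge // andbT.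
apply: leq_trans (word_length_nf_le _ _ _) _; rewrite leq_add2l (wtE le_n).
by case: m_n => ->; [apply: naf_addX | apply: naf_subX].
Qed.

Lemma pow_h7 h : 2 ^+ (h + 7) = 64 * 2 ^+ h.+1 :> int.
Proof. by rewrite -[(h + 7)%N]addSnnS exprD mulrC. Qed.

(** The next six weights are those of the numbers n of the three families and of
    their conjugates; the factor 64 keeps the low digits non-adjacent to w. *)
Lemma wt_m11 w : wt (64 * w - 11) = (wt w).+3.
Proof.
have -> : 64 * w - 11 = 4 * (4 * (4 * w - 1) + 1) + 1 by lia.
by rewrite !wt_4p1 wt_4m1.
Qed.

Lemma wt_m7 w : wt (64 * w - 7) = (wt w).+2.
Proof.
have -> : 64 * w - 7 = 4 * (2 * (4 * (2 * w) - 1)) + 1 by lia.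
by rewrite wt_4p1 wt_double wt_4m1 wt_double.
Qed.

Lemma wt_m15 w : wt (64 * w - 15) = (wt w).+2.
Proof.
have -> : 64 * w - 15 = 4 * (2 * (2 * (4 * w - 1))) + 1 by lia.
by rewrite wt_4p1 !wt_double wt_4m1.
Qed.

Lemma wt_p1 w : wt (64 * w + 1) = (wt w).+1.
Proof.
have -> : 64 * w + 1 = 4 * (2 * (2 * (2 * (2 * w)))) + 1 by lia.
by rewrite wt_4p1 !wt_double.
Qed.

Lemma wt_p5 w : wt (64 * w + 5) = (wt w).+2.
Proof.
have -> : 64 * w + 5 = 4 * (4 * (2 * (2 * w)) + 1) + 1 by lia.
by rewrite !wt_4p1 !wt_double.
Qed.

Lemma wt_m3 w : wt (64 * w - 3) = (wt w).+2.
Proof.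
have -> : 64 * w - 3 = 4 * (4 * (2 * (2 * w)) - 1) + 1 by lia.
by rewrite !wt_4p1 wt_4m1 !wt_double.
Qed.

(** The odd low digit 1 makes n / 4 a reduced fraction; conjugation by a^+-1 acts
    at the digit of 4.  Now -11 = 1 + 4 (-3), and both -3 + 1 and -3 - 1 have
    weight one less than -3, so that either conjugation saves a letter at this
    end.  In [neg_elt], 1 = 1 + 4 * 0, and 0 + 1 and 0 - 1 have weight one more
    than 0.  The height h + 7, one more than 64 v needs, leaves room for the
    conjugate by t, where k drops by one. *)
Definition zero_elt (v : int) (h : nat) : BS12 := bs_nf 2 (64 * v - 11) (h + 7).
Definition pos_elt (v : int) (h : nat) : BS12 :=
  bs_nf 2 (64 * (v + 2 ^+ h.+1) - 11) (h + 7).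
Definition neg_elt (v : int) (h : nat) : BS12 := bs_nf 2 (64 * v + 1) (h + 7).

Section Families.
Context (N : nat) (v : int) (h : nat) (vh : (v, h) \in sparse N).
Local Notation X := (2 ^+ h.+1 : int).

Let lenN : N = (h + wt v)%N. Proof. exact: sparse_cost vh. Qed.

Let bound7 i : (`|i| <= 64)%N -> (`|(64 * v + i)%R| <= 2 ^ (h + 7))%N.
Proof. by have /= := sparse_lt vh; rewrite expnD; lia. Qed.

Let bound6 i : (`|i| <= 64)%N -> (`|(64 * v + i)%R| <= 2 ^ (h + 6))%N.
Proof. by have /= := sparse_lt vh; rewrite expnD; lia. Qed.

Let wtX : wt (v + X) = (wt v).+1. Proof. exact: sparse_wt_addX vh. Qed.
Let wtNX : wt (v - X) = (wt v).+1. Proof. exact: sparse_wt_subX vh. Qed.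

Let red p i w : reduced (64 * w + (2 * i + 1), p, 0).
Proof. by rewrite /reduced /= orbC; lia. Qed.

Lemma zero_elt_length : word_length (zero_elt v h) = (N + 12)%N.
Proof.
rewrite word_length_nf ?(red _ (- 6)) ?bound7 // wt_m11 lenN; lia.
Qed.

Lemma neg_elt_length : word_length (neg_elt v h) = (N + 10)%N.
Proof.
rewrite word_length_nf ?(red _ 0) ?bound7 // wt_p1 lenN; lia.
Qed.

Lemma pos_elt_length : word_length (pos_elt v h) = (N + 13)%N.
Proof.
rewrite (@word_length_nf_overflow _ _ (64 * v - 11)) ?(red _ (- 6)) ?bound7 //.
- rewrite wt_m11 lenN; lia.
- by rewrite !wt_m11 wtX.
by left; rewrite pow_h7; lia.
Qed.

Lemma zero_elt_conj : conj_sum (zero_elt v h) = (4 * word_length (zero_elt v h))%N.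
Proof.
rewrite zero_elt_length /conj_sum /zero_elt conj_a conj_aV conj_tV.
rewrite (addnS h 6) conj_t -(addnS h 6) pow_h7.
have -> : 64 * v - 11 + 2 ^+ 2 - 64 * X = 64 * (v - X) - 7 by lia.
have -> : 64 * v - 11 - 2 ^+ 2 + 64 * X = 64 * (v + X) - 15 by lia.
rewrite (@word_length_nf_overflow _ _ (64 * v - 7)) ?(red _ (- 4)) ?bound7 //;
  [| by rewrite !wt_m7 wtNX | by right; rewrite pow_h7; lia].
rewrite (@word_length_nf_overflow _ _ (64 * v - 15)) ?(red _ (- 8)) ?bound7 //;
  [| by rewrite !wt_m15 wtX | by left; rewrite pow_h7; lia].
rewrite !word_length_nf ?(red _ (- 6)) ?bound6 //.
  rewrite wt_m7 wt_m15 wt_m11 lenN; lia.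
by rewrite expnS; have := @bound7 (-11) isT; lia.
Qed.

Lemma neg_elt_conj : (4 * word_length (neg_elt v h) < conj_sum (neg_elt v h))%N.
Proof.
rewrite neg_elt_length /conj_sum /neg_elt conj_a conj_aV conj_tV.
rewrite (addnS h 6) conj_t -(addnS h 6) pow_h7.
have -> : 64 * v + 1 + 2 ^+ 2 - 64 * X = 64 * (v - X) + 5 by lia.
have -> : 64 * v + 1 - 2 ^+ 2 + 64 * X = 64 * (v + X) - 3 by lia.
have := @word_length_nf_ge 2 (64 * (v - X) + 5) (h + 7) (red _ 2 _).
have := @word_length_nf_ge 2 (64 * (v + X) - 3) (h + 7) (red _ (- 2) _).
have := @word_length_nf_ge 1 (64 * v + 1) (h + 6) (red _ 0 _).
have := @word_length_nf_ge 3 (64 * v + 1) (h + 7).+1 (red _ 0 _).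
rewrite wt_p1 wt_p5 wt_m3 wtX wtNX lenN.
move: (word_length _) (word_length _) (word_length _) (word_length _); lia.
Qed.

(** Relative to the length L = N + 13, the four conjugates have lengths L - 2,
    at most L, at most L - 1 and at most L + 2. *)
Lemma pos_elt_conj : (conj_sum (pos_elt v h) < 4 * word_length (pos_elt v h))%N.
Proof.
rewrite pos_elt_length /conj_sum /pos_elt conj_a conj_aV conj_tV.
rewrite (addnS h 6) conj_t -(addnS h 6) pow_h7.
have -> : 64 * (v + X) - 11 + 2 ^+ 2 - 64 * X = 64 * v - 7 by lia.
have -> : 64 * (v + X) - 11 - 2 ^+ 2 + 64 * X = 64 * v - 15 + 64 * X + 64 * X by lia.
have len_a : word_length (bs_nf 2 (64 * v - 7) (h + 7)) = (N + 11)%N.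
  rewrite word_length_nf ?(red _ (- 4)) ?bound7 // wt_m7 lenN; lia.
have len_aV : (word_length (bs_nf 2 (64 * v - 15 + 64 * X + 64 * X) (h + 7)) <= N + 13)%N.
  apply: leq_trans (word_length_nf_le _ _ _) _; rewrite -pow_h7.
  apply: leq_trans (leq_add (leqnn _) (naf_addX _ (leqnn _))) _.
  have := naf_addX (64 * v - 15) (leqnn (h + 7)).
  rewrite -(@wtE (h + 7) (64 * v - 15)) ?bound7 // wt_m15 lenN.
  by move: (naf _ _); lia.
have len_t : (word_length (bs_nf 1 (64 * (v + X) - 11) (h + 6)) <= N + 12)%N.
  apply: leq_trans (word_length_nf_le _ _ _) _.
  have -> : 64 * (v + X) - 11 = 64 * v - 11 + 2 ^+ (h + 6) + 2 ^+ (h + 6).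
    by have := pow_h7 h; rewrite (addnS h 6) exprS; lia.
  apply: leq_trans (leq_add (leqnn _) (naf_addX _ (leqnn _))) _.
  have := naf_addX (64 * v - 11) (leqnn (h + 6)).
  rewrite -(@wtE (h + 6) (64 * v - 11)) ?bound6 // wt_m11 lenN.
  by move: (naf _ _); lia.
have len_tV : (word_length (bs_nf 3 (64 * (v + X) - 11) (h + 7).+1) <= N + 15)%N.
  apply: leq_trans (word_length_nf_le _ _ _) _.
  have -> : 64 * (v + X) - 11 = 64 * v - 11 + 2 ^+ (h + 7) by rewrite pow_h7; lia.
  apply: leq_trans (leq_add (leqnn _) (naf_addX _ (leqnSn _))) _.
  rewrite -(@wtE (h + 7).+1 (64 * v - 11)) ?wt_m11 ?lenN; first lia.
  by rewrite expnS; have := @bound7 (-11) isT; lia.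
rewrite len_a; move: len_aV len_t len_tV.
move: (word_length _) (word_length _) (word_length _); lia.
Qed.

End Families.

Definition family (F : int -> nat -> BS12) : set BS12 :=
  [set g | exists N c, c \in sparse N /\ g = F c.1 c.2].

Lemma zero_elt_inj (c c' : int * nat) :
  zero_elt c.1 c.2 = zero_elt c'.1 c'.2 -> c = c'.
Proof.
case: c c' => [v h] [v' h'] /=; rewrite /zero_elt => /bs_nf_inj[];
  rewrite /reduced /=; try lia.
by move=> _ ev /addIn ->; congr (_, _); lia.
Qed.

Lemma neg_elt_inj (c c' : int * nat) :
  neg_elt c.1 c.2 = neg_elt c'.1 c'.2 -> c = c'.
Proof.
case: c c' => [v h] [v' h'] /=; rewrite /neg_elt => /bs_nf_inj[];
  rewrite /reduced /=; try lia.
by move=> _ ev /addIn ->; congr (_, _); lia.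
Qed.

Lemma pos_elt_inj (c c' : int * nat) :
  pos_elt c.1 c.2 = pos_elt c'.1 c'.2 -> c = c'.
Proof.
case: c c' => [v h] [v' h'] /=; rewrite /pos_elt => /bs_nf_inj[];
  rewrite /reduced /=; try lia.
by move=> _ ev /addIn eh; move: ev; rewrite eh => ev; congr (_, _); lia.
Qed.

Lemma family_card F d :
  (forall c c' : int * nat, F c.1 c.2 = F c'.1 c'.2 -> c = c') ->
  (forall N v h, (v, h) \in sparse N -> word_length (F v h) = (N + d)%N) ->
  forall N, (growth N <= bs_card (family F `&` sphere (N + d)))%N.
Proof.
move=> F_inj F_len N; pose s := [seq F c.1 c.2 | c <- sparse N].
rewrite -[growth N](size_map (fun c => F c.1 c.2)); apply: bs_card_ge.
- by apply: sub_finite_set (@finite_sphere (N + d)) => g [].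
- by rewrite map_inj_in_uniq ?sparse_uniq // => c c' _ _; apply: F_inj.
move=> g /mapP[[v h] cN ->]; split; first by exists N, (v, h).
exact: F_len cN.
Qed.

(** * Densities *)

Lemma bs_card_disjoint (A B : set BS12) N : A `&` B = set0 ->
  (bs_card (A `&` sphere N) + bs_card (B `&` sphere N) <= bs_card (sphere N))%N.
Proof.
have fin (C : set BS12) : finite_set (C `&` sphere N).
  by apply: sub_finite_set (@finite_sphere N) => g [].
move=> AB0; rewrite /bs_card -cardfsUI -fset_setU // -fset_setI //.
have -> : A `&` sphere N `&` (B `&` sphere N) = set0.
  by rewrite setIACA AB0 set0I.
rewrite fset_set0 cardfs0 addn0 fsubset_leq_card //.
rewrite -fset_set_sub //;
  [by move=> g [[]|[]] | by rewrite finite_setU | exact: finite_sphere].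
Qed.

(** A set with a positive lower density has upper density below one as soon as it
    misses another set with a positive lower density. *)
Lemma positive_density_disjoint (R : realType) (A B : set BS12) d d' :
  A `&` B = set0 ->
  (forall N, growth N <= bs_card (A `&` sphere (N + d)))%N ->
  (forall N, growth N <= bs_card (B `&` sphere (N + d')))%N ->
  positive_density R A.
Proof.
move=> AB0 cA cB; pose K := (3000 * 3 ^ (d + d'))%N.
have K0 : (0 < K)%N by rewrite muln_gt0 expn_gt0.
have lower C e : (e <= d + d')%N ->
    (forall N, growth N <= bs_card (C `&` sphere (N + e)))%N -> forall M, (e <= M)%N ->
    (0 < bs_card (C `&` sphere M))%N /\
    (bs_card (sphere M) <= K * bs_card (C `&` sphere M))%N.
  move=> le_e cC M leM; have := cC (M - e)%N; rewrite subnK // => cM.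
  split; first exact: leq_trans (growth_gt0 _) cM.
  apply: leq_trans (bs_card_sphere_le M) _; rewrite /K -mulnA leq_pmul2l //.
  rewrite -{1}(subnK leM); apply: leq_trans (growth_addn_le _ _) _.
  by apply: leq_mul cM; rewrite leq_pexp2l.
exists (2 * K)%:R^-1; first by rewrite invr_gt0 ltr0n muln_gt0.
exists (d + d')%N => // M /= leM.
have [a0 sA] := lower A d (leq_addr _ _) cA M (leq_trans (leq_addr _ _) leM).
have [b0 sB] := lower B d' (leq_addl _ _) cB M (leq_trans (leq_addl _ _) leM).
have := bs_card_disjoint M AB0.
move: (bs_card (A `&` _)) (bs_card (B `&` _)) (bs_card (sphere M)) a0 b0 sA sB.
move=> a b s a0 b0 sA sB ab.
have s0 : (0 < s)%N by apply: leq_trans (leq_trans a0 (leq_addr b a)) ab.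
have sR : 0 < s%:R :> R by rewrite ltr0n.
have KR : 0 < (2 * K)%:R :> R by rewrite ltr0n muln_gt0.
apply/andP; split.
  rewrite ltr_pdivlMr // mulrC ltr_pdivrMr // -natrM ltr_nat; nia.
rewrite ltrBrDl -ltrBrDr -[X in X - _](divff (lt0r_neq0 sR)) -mulrBl.
rewrite ltr_pdivlMr // mulrC ltr_pdivrMr // -natrB; last by nia.
by rewrite -natrM ltr_nat; nia.
Qed.

Theorem theorem6p6 (R : realType) :
  exists Apos Aneg Azero : set BS12,
    [/\ positive_density R Apos, positive_density R Aneg
      & positive_density R Azero] /\
    [/\ forall g : BS12, Apos g -> g <> 1%g /\ 0 < conj_curvature R 1 g,
        forall g : BS12, Aneg g -> g <> 1%g /\ conj_curvature R 1 g < 0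
      & forall g : BS12, Azero g -> g <> 1%g /\ conj_curvature R 1 g = 0].
Proof.
have ne1 g : (0 < word_length g)%N -> g <> 1%g by move=> g0 g1; rewrite g1 word_length1 in g0.
have curv_pos g : family pos_elt g -> g <> 1%g /\ 0 < conj_curvature R 1 g.
  case=> N [[v h] [vh ->]]; have l0 : (0 < word_length (pos_elt v h))%N.
    by rewrite (pos_elt_length vh) addnS.
  by split; [apply: ne1 | apply: conj_curvature1_gt0 => //; apply: pos_elt_conj vh].
have curv_neg g : family neg_elt g -> g <> 1%g /\ conj_curvature R 1 g < 0.
  case=> N [[v h] [vh ->]]; have l0 : (0 < word_length (neg_elt v h))%N.
    by rewrite (neg_elt_length vh) addnS.
  by split; [apply: ne1 | apply: conj_curvature1_lt0 => //; apply: neg_elt_conj vh].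
have curv_zero g : family zero_elt g -> g <> 1%g /\ conj_curvature R 1 g = 0.
  case=> N [[v h] [vh ->]]; have l0 : (0 < word_length (zero_elt v h))%N.
    by rewrite (zero_elt_length vh) addnS.
  by split; [apply: ne1 | apply: conj_curvature1_eq0 => //; apply: zero_elt_conj vh].
have card_pos := family_card pos_elt_inj (fun N v h => @pos_elt_length N v h).
have card_neg := family_card neg_elt_inj (fun N v h => @neg_elt_length N v h).
have card_zero := family_card zero_elt_inj (fun N v h => @zero_elt_length N v h).
exists (family pos_elt), (family neg_elt), (family zero_elt).
have pos_neg : family pos_elt `&` family neg_elt = set0.
  by apply/seteqP; split=> // g [/curv_pos[_ kp] /curv_neg[_ /(lt_trans kp)]]; rewrite ltxx.
have zero_pos : family zero_elt `&` family pos_elt = set0.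
  by apply/seteqP; split=> // g [/curv_zero[_ k0] /curv_pos[_]]; rewrite k0 ltxx.
split; last by [].
split.
- exact: positive_density_disjoint pos_neg card_pos card_neg.
- by apply: positive_density_disjoint card_neg card_pos; rewrite setIC.
exact: positive_density_disjoint zero_pos card_zero card_pos.
Qed.
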